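(* If the feasible set $\mathcal X$ is compact, then the optimal value of the distributionally robust problem at time $t$ converges over time to the optimal value of the stochastic optimization problem with probability 1: with $$\widehat J_t=\min_{x\in\mathcal X}\max_{p\in\mathcal P_t}\mathbb E_{s\sim p}[f(x,s)],\qquad J^*=\min_{x\in\mathcal X}\mathbb E_{s\sim p^*}[f(x,s)],$$ one has $\lim_{t\to\infty}\widehat J_t=J^*$ with probability 1.
   Context: Scenarios: $\mathcal S=\{s_1,\dots,s_{|\mathcal S|}\}$ is a finite set, $\mathcal X\subseteq\mathbb R^d$ is the feasible set, $f:\mathcal X\times\mathcal S\to\mathbb R$ is the objective function, and $\mathcal P_0=\{p\in[0,1]^{|\mathcal S|}:\sum_k p_k=1\}$ is the probability simplex. For $p\in\mathcal P_0$, $\mathbb E_{s\sim p}[f(x,s)]=\sum_{k}f(x,s_k)p_k$. $p^*\in\mathcal P_0$ is the true distribution; i.i.d. scenarios are drawn from $p^*$, and $\hat p_t$ is the empirical distribution of the first $t$ observations. Minima over $\mathcal X$ are read as infima if not attained. Ambiguity sets: fix $\delta\in(0,1)$ and $\delta_t=\frac{6\delta}{\pi^2t^2}$. For $t\ge1$, $\mathcal P_t$ is of one of the following types (the same type for all $t$): (1) confidence intervals: $\mathcal P_t=\{p\in\mathcal P_0: l_t\le p\le u_t\}$ with $l_{kt}=\hat p_{kt}-\frac{z_{\delta_t/2}}{2\sqrt t}$, $u_{kt}=\hat p_{kt}+\frac{z_{\delta_t/2}}{2\sqrt t}$, where $z_{\delta_t/2}$ is the $(1-\frac{\delta_t}{2})$-quantile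 of the standard normal distribution; (2) $\ell_2$-norm sets: $\mathcal P_t=\{p\in\mathcal P_0:\|p-\hat p_t\|_2\le\epsilon_t\}$ with $\epsilon_t=\sqrt{\frac{2|\mathcal S|\log(2/\delta_t)}{t}}$; (3) kernel based sets: $\mathcal P_t=\{p\in\mathcal P_0:\|p-\hat p_t\|_M\le\epsilon_t\}$ with $\epsilon_t=\frac{\sqrt C}{\sqrt t}\big(2+\sqrt{2\log(1/\delta_t)}\big)$, where $M=(k_M(s_i,s_j))_{i,j}$ is the (positive definite) matrix of a kernel $k_M:\mathcal S\times\mathcal S\to\mathbb R$ with $k_M(s_i,s_j)\le C$, and $\|q\|_M=\sqrt{q^\top Mq}$. Standing assumption: the sets are constructed so that $\mathbb P(p^*\in\mathcal P_t)\ge1-\delta_t$ for every $t\ge1$. *)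

(* Defs.v *)
From mathcomp Require Import all_boot all_order all_algebra.
From mathcomp Require Import finmap.
From mathcomp Require Import all_classical all_reals all_analysis.
Export numFieldNormedType.Exports.

Set Implicit Arguments.
Unset Strict Implicit.
Unset Printing Implicit Defensive.

Import Order.TTheory GRing.Theory Num.Theory.

Local Open Scope classical_set_scope.
Local Open Scope ring_scope.

Section scenarios.
Context {R : realType} {S : finType}.

(* The scenarios are numbered s_0, ..., s_{|S|-1} by the enumeration of S; a
   vector indexed by scenarios is a column of height |S|. *)
Definition scenario (k : 'I_#|S|) : S := enum_val k.

Definition simplex : set 'cV[R]_#|S| :=
  [set p | (forall k, 0 <= p k 0 <= 1) /\ \sum_k p k 0 = 1].

Definition expected_value (p : 'cV[R]_#|S|) (g : S -> R) : R :=
  \sum_k g (scenario k) * p k 0.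

Definition l2norm (q : 'cV[R]_#|S|) : R := Num.sqrt (\sum_k q k 0 ^+ 2).

Definition mxnorm (M : 'M[R]_#|S|) (q : 'cV[R]_#|S|) : R :=
  Num.sqrt ((q^T *m M *m q) 0 0).

Definition posdefmx (M : 'M[R]_#|S|) : Prop :=
  M^T = M /\ forall q : 'cV[R]_#|S|, q != 0 -> 0 < (q^T *m M *m q) 0 0.

Definition kernel_mx (kM : S -> S -> R) : 'M[R]_#|S| :=
  \matrix_(i, j) kM (scenario i) (scenario j).

End scenarios.

Section iid_scenarios.
Context {R : realType} {S : finType} {disp : measure_display}
  {Omega : measurableType disp} (P : probability Omega R).

(* S carries the discrete sigma-algebra. *)
Definition iid_scenarios (xi : nat -> Omega -> S) (p : 'cV[R]_#|S|) : Prop :=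
  [/\ forall i (A : set S), measurable (xi i @^-1` A),
      forall i k, P (xi i @^-1` [set scenario k]) = (p k 0)%:E &
      forall (I : {fset nat}) (A : nat -> set S),
        P (\bigcap_(i in [set` I]) (xi i @^-1` A i)) =
        (\prod_(i <- I) fine (P (xi i @^-1` A i)))%:E].

(* The observations made up to time t are xi 0, ..., xi (t - 1). *)
Definition empirical (xi : nat -> Omega -> S) (t : nat) (w : Omega) :
  'cV[R]_#|S| := \col_k (#|[set i : 'I_t | xi i w == scenario k]%SET|%:R / t%:R).

End iid_scenarios.

Section ambiguity_sets.
Context {R : realType}.

Definition std_normal_quantile (q : R) : R :=
  inf [set x : R | (q%:E <= normal_prob 0 1 `]-oo, x])%E].

Definition delta_at (delta : R) (t : nat) : R :=
  6 * delta / (pi ^+ 2 * t%:R ^+ 2).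

Definition ci_radius (delta : R) (t : nat) : R :=
  std_normal_quantile (1 - delta_at delta t / 2) / (2 * Num.sqrt t%:R).

Definition l2_radius (n : nat) (delta : R) (t : nat) : R :=
  Num.sqrt (2 * n%:R * ln (2 / delta_at delta t) / t%:R).

Definition kernel_radius (C : R) (delta : R) (t : nat) : R :=
  Num.sqrt C / Num.sqrt t%:R * (2 + Num.sqrt (2 * ln (1 / delta_at delta t))).

Context {S : finType}.

Inductive ambiguity_type :=
| ConfidenceIntervals
| L2Norm
| KernelBased (kM : S -> S -> R) (C : R).

Definition valid_ambiguity (a : ambiguity_type) : Prop :=
  if a is KernelBased kM C then
    posdefmx (kernel_mx kM) /\ forall s s', kM s s' <= C
  else True.

Definition ambiguity_set (a : ambiguity_type) (delta : R) (t : nat)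
    (phat : 'cV[R]_#|S|) : set 'cV[R]_#|S| :=
  match a with
  | ConfidenceIntervals =>
      [set p | simplex p /\ forall k,
         phat k 0 - ci_radius delta t <= p k 0 <= phat k 0 + ci_radius delta t]
  | L2Norm =>
      [set p | simplex p /\ l2norm (p - phat) <= l2_radius #|S| delta t]
  | KernelBased kM C =>
      [set p | simplex p /\
         mxnorm (kernel_mx kM) (p - phat) <= kernel_radius C delta t]
  end.

End ambiguity_sets.
Arguments ambiguity_type : clear implicits.

Section optimal_values.
Context {R : realType} {S : finType} {T : Type}.
Local Open Scope ereal_scope.

(* Optimal values live in \bar R: f is an arbitrary function, so an infimum over
   X may be -oo, and it is +oo when X is empty. *)
Definition stochastic_value (X : set T) (f : T -> S -> R) (p : 'cV[R]_#|S|) :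
  \bar R := ereal_inf [set (expected_value p (f x))%:E | x in X].

Definition robust_value (X : set T) (f : T -> S -> R) (Q : set 'cV[R]_#|S|) :
  \bar R :=
  ereal_inf [set ereal_sup [set (expected_value p (f x))%:E | p in Q] | x in X].

End optimal_values.

(* Main.v *)
(* On the event that [pstar] lies in the ambiguity set at time [t], the robust
   value is at least the stochastic value. Since [delta_at delta t] is summable,
   Borel-Cantelli makes this event hold for all large [t] almost surely. All
   three radii are at most [(A + B * ln (2 / delta_at delta t)) / sqrt t], so the
   ambiguity sets containing [pstar] shrink to it uniformly; at an almost optimal
   fixed [x] the worst-case expectation then tends to the true one, which gives
   the upper bound. *)
Require Import Defs.
From mathcomp Require Import all_boot all_order all_algebra.
From mathcomp Require Import all_classical all_reals all_analysis.
From mathcomp Require Import measurable_realfun.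
From mathcomp Require Import ring lra.
Import Order.TTheory GRing.Theory Num.Theory.
Local Open Scope classical_set_scope.
Local Open Scope ring_scope.

(** * Deterministic convergence of robust values *)

(** Serves a limit approached from above; [l] may be infinite, and then one of the two hypotheses
    alone gives the convergence. *)
Lemma cvge_ge_lim {R : realType} {T : Type} (F : set_system T) {FF : Filter F}
    (u : T -> \bar R) (l : \bar R) :
  (\forall t \near F, (l <= u t)%E) ->
  (forall b : R, (l < b%:E)%E -> \forall t \near F, (u t <= b%:E)%E) ->
  u t @[t --> F] --> l.
Proof.
case: l => [r| |] lu ub.
- have ufin : \forall t \near F, u t \is a fin_num.
    have ltr1 : (r%:E < (r + 1)%:E)%E by rewrite lte_fin ltrDl.
    near=> t; rewrite fin_numE; apply/andP; split.
    + rewrite gt_eqF// (lt_le_trans (ltNyr r))//; near: t; exact: lu.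
    + rewrite lt_eqF// (le_lt_trans _ (ltry (r + 1)))//; near: t; exact: ub.
  apply/fine_cvgP; split => //; apply/cvgrPdist_le => e e0.
  have ltre : (r%:E < (r + e)%:E)%E by rewrite lte_fin ltrDl.
  near=> t.
  have tfin : u t \is a fin_num by near: t.
  have /= : (r%:E <= (fine (u t))%:E)%E by rewrite fineK//; near: t.
  have : ((fine (u t))%:E <= (r + e)%:E)%E.
    by rewrite fineK//; near: t; exact: ub.
  rewrite !lee_fin => h1 h2; rewrite distrC ger0_norm ?subr_ge0//.
  by rewrite lerBlDl.
- by apply/cvgeyPge => A; apply: filterS lu => t; exact: le_trans (leey _).
- by apply/cvgeNyPle => A; apply: ub; rewrite ltNyr.
Unshelve. all: by end_near. Qed.

(** The deterministic core, applied to one outcome at a time. For the upper bound, a single [x] with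
    value below [b] is fixed before [t] grows. *)
Lemma robust_value_cvg {R : realType} {S : finType} {T : Type} (X : set T)
    (f : T -> S -> R) (p0 : 'cV[R]_#|S|) (Q : nat -> set 'cV[R]_#|S|)
    (rho : nat -> R) :
  (\forall t \near \oo, Q t p0) ->
  rho t @[t --> \oo] --> 0 ->
  (\forall t \near \oo, forall p, Q t p -> forall k, `|p k 0 - p0 k 0| <= rho t) ->
  robust_value X f (Q t) @[t --> \oo] --> stochastic_value X f p0.
Proof.
move=> Qp0 rho0 Qrho; apply: cvge_ge_lim.
  apply: filterS Qp0 => t Qtp0; apply: le_ereal_inf_tmp => _ [x Xx <-].
  apply: ereal_inf_le => /=.
  exists ((expected_value p0 (f x))%:E); first by exists x.
  by apply: ereal_sup_ubound; exists p0.
move=> b /ereal_inf_lt[_ [x Xx <-]]; rewrite lte_fin => xb.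
(* Moving each coordinate of [p0] by at most [rho t] changes the expectation at [x] by at most
   [K * rho t]. *)
set K := \sum_k `|f x (scenario k)|.
have K0 : 0 <= K by apply: sumr_ge0.
have rhob : \forall t \near \oo, K * rho t <= b - expected_value p0 (f x).
  have /cvgrPdist_le : K * rho t @[t --> \oo] --> K * 0 by apply: cvgMl_tmp.
  move=> /(_ (b - expected_value p0 (f x))); rewrite subr_gt0 => /(_ xb).
  apply: filterS => t; rewrite mulr0 sub0r normrN.
  by apply: le_trans; exact: ler_norm.
near=> t.
apply: ereal_inf_le => /=.
exists (ereal_sup [set (expected_value p (f x))%:E | p in Q t]); first by exists x.
apply: ge_ereal_sup => _ [p Qp <-].
rewrite lee_fin -(lerD2r (- expected_value p0 (f x))).
apply: le_trans (_ : K * rho t <= _); last by near: t.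
rewrite /expected_value -sumrB mulr_suml; apply: ler_sum => k _.
rewrite -mulrBr (le_trans (ler_norm _))// normrM ler_wpM2l//.
by move: p Qp k; near: t.
Unshelve. all: by end_near. Qed.

(** * Tail and quantiles of the standard normal law *)

(* Exponential tilting: on [y > x] the density of N(0, 1) is at most
   [expR (2^-1 - x)] times that of N(1, 1). *)
Lemma normal_prob_tail {R : realType} (x : R) :
  (normal_prob 0 1 `]x, +oo[ <= (expR (2^-1 - x))%:E)%E.
Proof.
have mpdf m : measurable_fun `]x, +oo[ (EFin \o normal_pdf m 1).
  by apply/measurable_EFinP/measurable_funTS; exact: measurable_normal_pdf.
rewrite /normal_prob.
apply: (@le_trans _ _ ((expR (2^-1 - x))%:E * normal_prob 1 1 `]x, +oo[)%E).
  have <- : (\int[lebesgue_measure]_(y in `]x, +oo[)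
      ((expR (2^-1 - x))%:E * (normal_pdf 1 1 y)%:E) =
      (expR (2^-1 - x))%:E * normal_prob 1 1 `]x, +oo[)%E.
    apply: ge0_integralZl_EFin; rewrite ?expR_ge0//.
    + by move=> y _; rewrite lee_fin normal_pdf_ge0.
    + exact: mpdf.
  apply: ge0_le_integral => //.
  - by move=> y _; rewrite lee_fin normal_pdf_ge0.
  - exact: mpdf.
  - by apply: measurable_funeM; exact: mpdf.
  move=> y; rewrite /= in_itv/= andbT => xy.
  rewrite -EFinM lee_fin !normal_pdfE ?oner_neq0//.
  rewrite mulrCA ler_wpM2l ?normal_peak_ge0// /normal_fun -expRD ler_expR.
  by rewrite subr0 expr1n -mulr_natr mul1r; lra.
rewrite -[leRHS]mule1 lee_wpmul2l ?lee_fin ?expR_ge0//.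
exact: probability_le1.
Qed.

(* [inf] of a set that is not bounded below is [0]: hence the hypothesis on [x]. *)
Lemma inf_le_ge0 {R : realType} (E : set R) (x : R) : E x -> 0 <= x -> inf E <= x.
Proof.
move=> Ex x0; have [lbE|nlbE] := pselect (has_lbound E); first exact: ge_inf.
by rewrite inf_out// => -[].
Qed.

(** The tilted tail bound at this point equals [e], so the point lies in the set whose infimum is
    the quantile; [e <= 1] makes it nonnegative. *)
Lemma std_normal_quantile_le {R : realType} (e : R) : 0 < e <= 1 ->
  std_normal_quantile (1 - e) <= 2^-1 + ln e^-1.
Proof.
move=> /andP[e0 e1]; set x := 2^-1 + ln e^-1.
have x0 : 0 <= x by rewrite addr_ge0 ?invr_ge0// ln_ge0// invf_ge1.
apply: inf_le_ge0 => //=.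
have tail : (normal_prob 0 1 `]x, +oo[ <= e%:E)%E.
  apply: le_trans (normal_prob_tail _) _; rewrite lee_fin /x opprD addrA subrr sub0r.
  by rewrite lnV// opprK lnK.
have -> : [set` `]-oo, x]] = ~` [set` `]x, +oo[] :> set R by rewrite setCitvr.
rewrite probability_setC// EFinB; exact: leeB.
Qed.

(** * Coordinates bounded by a positive definite form *)

(** A row [v] with [v *m M = 0] makes the form vanish at its transpose, so positivity forces
    [v = 0]. *)
Lemma posdefmx_unit {R : realType} {S : finType} (M : 'M[R]_#|S|) :
  posdefmx M -> M \in unitmx.
Proof.
move=> [Msym Mpos]; rewrite -row_free_unit; apply: inj_row_free => v vM.
apply/eqP; rewrite -trmx_eq0; apply: contraTT isT => /Mpos.
by rewrite trmxK vM mul0mx mxE ltxx.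
Qed.

(* Cauchy-Schwarz for the form of [M], since [q k 0] is the form evaluated at
   [q] and the [k]-th column of [invmx M]. *)
Lemma posdefmx_coord {R : realType} {S : finType} (M : 'M[R]_#|S|) :
  posdefmx M -> exists2 c : R, 0 <= c &
    forall (q : 'cV[R]_#|S|) k, `|q k 0| <= c * mxnorm M q.
Proof.
move=> Mpd; have Mu := posdefmx_unit _ Mpd; case: (Mpd) => Msym Mpos.
have M_ge0 (q : 'cV[R]_#|S|) : 0 <= (q^T *m M *m q) 0 0.
  by have [->|/Mpos/ltW//] := eqVneq q 0; rewrite mulmx0 mxE.
have key (q : 'cV[R]_#|S|) k :
    0 <= invmx M k k /\ (q k 0) ^+ 2 <= invmx M k k * (q^T *m M *m q) 0 0.
  set B := _ 0 0; set c := invmx M k k.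
  set u : 'cV[R]_#|S| := col k (invmx M).
  have Mk : M *m u = delta_mx k 0 by rewrite /u colE mulmxA mulmxV// mul1mx.
  have uM : u^T *m M = delta_mx 0 k.
    by rewrite -[M in LHS]Msym -trmx_mul Mk trmx_delta.
  have uMq (v : 'cV[R]_#|S|) : (u^T *m M *m v) 0 0 = v k 0.
    by rewrite uM -rowE mxE.
  have qMu : (q^T *m M *m u) 0 0 = q k 0 by rewrite -mulmxA Mk -colE !mxE.
  have uk : u k 0 = c by rewrite mxE.
  have quad (a b : R) : ((a *: q - b *: u)^T *m M *m (a *: q - b *: u)) 0 0 =
     a ^+ 2 * B - 2 * (a * b * q k 0) + b ^+ 2 * c.
    rewrite [(_ - _)^T]linearB/= ![(_ *: _)^T]linearZ/= !mulmxBl !mulmxBr.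
    rewrite -!scalemxAr -!scalemxAl.
    have subE (x y : 'M[R]_1) : (x - y) 0 0 = x 0 0 - y 0 0 by rewrite !mxE.
    have scaleE (e : R) (x : 'M[R]_1) : (e *: x) 0 0 = e * x 0 0 by rewrite mxE.
    rewrite !(subE, scaleE) -/B qMu !uMq uk.
    ring.
  have c_gt0 : 0 < c.
    rewrite -uk -uMq; apply: Mpos; apply: contraTneq isT => u0.
    have /matrixP/(_ k 0) := Mk; rewrite u0 mulmx0 !mxE !eqxx/=.
    by move=> /eqP; rewrite eq_sym oner_eq0.
  split; first exact: ltW.
  (* This vector is [c] times the part of [q] orthogonal to [u] for the form. *)
  have := M_ge0 (c *: q - q k 0 *: u); rewrite quad.
  have -> : c ^+ 2 * B - 2 * (c * q k 0 * q k 0) + q k 0 ^+ 2 * c =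
            c * (c * B - q k 0 ^+ 2) by ring.
  by rewrite pmulr_rge0// subr_ge0.
exists (\sum_k Num.sqrt (invmx M k k)).
  by apply: sumr_ge0 => k _; exact: sqrtr_ge0.
move=> q k; have [ck qk] := key q k.
apply: (@le_trans _ _ (Num.sqrt (invmx M k k) * mxnorm M q)).
  by rewrite -sqrtr_sqr -sqrtrM// ler_sqrt// (le_trans (sqr_ge0 _) qk).
rewrite ler_wpM2r ?sqrtr_ge0// (bigD1 k)//= lerDl.
by apply: sumr_ge0 => *; exact: sqrtr_ge0.
Qed.

(** * Almost sure events and measurability *)

(** The exceptional null set is the limit superior of the complements: a point outside it lies in
    only finitely many of them. *)
Lemma Borel_Cantelli_event {R : realType} {disp : measure_display}
    {Omega : measurableType disp} (P : probability Omega R)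
    (E : nat -> set Omega) :
  (forall t, measurable (E t)) ->
  (\sum_(0 <= t <oo) P (~` E t) < +oo)%E ->
  {ae P, forall w, \forall t \near \oo, E t w}.
Proof.
move=> mE sumE; exists (lim_sup_set (fun t => ~` E t)); split.
- apply: bigcapT_measurable => n; apply: bigcup_measurable => k _.
  exact: measurableC.
- by apply: lim_sup_set_cvg0 => // t; exact: measurableC.
move=> w /= nE n _; apply: contrapT => nF; apply: nE.
exists n => // t /= nt; apply: contrapT => nEt; apply: nF.
by exists t.
Qed.

(** The empirical distribution depends on the finite tuple of the first [t] observations, so the
    event is a finite union of finite intersections of measurable events, whatever the set [A]. *)
Lemma measurable_empirical {R : realType} {S : finType}
    {disp : measure_display} {Omega : measurableType disp}
    (xi : nat -> Omega -> S) (A : set 'cV[R]_#|S|) (t : nat) :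
  (forall i (B : set S), measurable (xi i @^-1` B)) ->
  measurable [set w | A (empirical xi t w)].
Proof.
move=> mxi.
pose h (g : {ffun 'I_t -> S}) : 'cV[R]_#|S| :=
  \col_k (#|[set i : 'I_t | g i == scenario k]%SET|%:R / t%:R).
have hE w : empirical xi t w = h [ffun i : 'I_t => xi i w].
  apply/matrixP => k j; rewrite !mxE; congr (_%:R / _).
  by apply: eq_card => i; rewrite !inE ffunE.
rewrite (_ : mkset _ = \bigcup_(g in [set g | A (h g)])
    \bigcap_(i in [set: 'I_t]) (xi i @^-1` [set g i])).
  apply: fin_bigcup_measurable => // g _.
  by apply: fin_bigcap_measurable.
apply/seteqP; split => w /=.
  rewrite hE => Ah; exists [ffun i : 'I_t => xi i w] => //= i _.
  by rewrite /= ffunE.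
move=> [g /= Ag gw]; rewrite hE (_ : [ffun i => _] = g)//.
by apply/ffunP => i; rewrite ffunE gw.
Qed.

(** * Estimates for the levels [delta_at] and limits of the rates *)

Lemma sum_inv_sqr_le2 {R : realType} (n : nat) :
  \sum_(0 <= t < n) (t.+1%:R ^- 2 : R) <= 2.
Proof.
(* The sharper bound carries the induction: with [x = n.+1], its increment [2 / (x * (x + 1))]
   dominates [x ^- 2] because [x >= 1]. *)
suff h : \sum_(0 <= t < n) (t.+1%:R ^- 2 : R) <= 2 * (1 - n.+1%:R^-1).
  apply: le_trans h _; rewrite mulrBr mulr1 gerBl mulr_ge0 ?invr_ge0//.
elim: n => [|n IH]; first by rewrite big_nil invr1 subrr mulr0.
rewrite big_nat_recr//=; apply: le_trans (lerD IH (lexx _)) _.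
have n0 : (0 : R) < n.+1%:R by rewrite ltr0n.
have n1 : (1 : R) <= n.+1%:R by rewrite ler1n.
rewrite -[n.+2%:R]natr1; set x : R := n.+1%:R in n0 n1 *.
rewrite -subr_ge0.
rewrite (_ : _ - _ = (x - 1) / (x ^+ 2 * (x + 1))).
  by rewrite divr_ge0 ?subr_ge0// mulr_ge0 ?sqr_ge0//; lra.
by field; rewrite !gt_eqF//; lra.
Qed.

Lemma delta_at_gt0 {R : realType} (delta : R) (t : nat) :
  0 < delta -> (0 < t)%N -> 0 < delta_at delta t.
Proof.
move=> d0 t0; rewrite /delta_at divr_gt0 ?mulr_gt0 ?exprn_gt0 ?pi_gt0//.
  by rewrite ltr0n.
by rewrite ltr0n.
Qed.

(** From [pi >= 2] the level is at most [6 / 4]. This keeps [ln (2 / delta_at delta t)] nonnegative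
    in the radius bounds. *)
Lemma delta_at_le2 {R : realType} (delta : R) (t : nat) :
  0 < delta < 1 -> (0 < t)%N -> delta_at delta t <= 2.
Proof.
move=> /andP[d0 d1] t0; rewrite /delta_at ler_pdivrMr; last first.
  by rewrite mulr_gt0// exprn_gt0 ?pi_gt0 ?ltr0n.
have p2 := pi_ge2 R; have t1 : (1 : R) <= t%:R by rewrite ler1n.
have : 4 <= (pi : R) ^+ 2.
  by rewrite (_ : 4 = 2 ^+ 2 :> R) ?lerXn2r ?nnegrE//; [lra|ring].
have : 1 <= (t%:R : R) ^+ 2 by rewrite expr_ge1//.
nra.
Qed.

Lemma inv_sqrt_cvg0 {R : realType} :
  (Num.sqrt (t%:R : R))^-1 @[t --> \oo] --> 0.
Proof.
rewrite -[X in _ --> X](sqrtr0 R).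
under eq_fun do rewrite -sqrtrV//.
apply: continuous_cvg; first exact: sqrt_continuous.
by rewrite -cvg_shiftS; exact: cvg_harmonic.
Qed.

(** Squeezed between 0 and [4 * t ^ (-1/4)]. *)
Lemma ln_div_sqrt_cvg0 {R : realType} :
  ln (t%:R : R) / Num.sqrt t%:R @[t --> \oo] --> 0.
Proof.
have inv0 : (t%:R : R)^-1 @[t --> \oo] --> 0.
  by rewrite -cvg_shiftS; exact: cvg_harmonic.
have root0 : 4 * Num.sqrt (Num.sqrt (t%:R : R)^-1) @[t --> \oo] --> 0.
  rewrite -[X in _ --> X](mulr0 4); apply: cvgMl_tmp.
  rewrite -[X in _ --> X]sqrtr0 -[X in _ --> Num.sqrt X]sqrtr0.
  apply: continuous_cvg; first exact: sqrt_continuous.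
  by apply: continuous_cvg; first exact: sqrt_continuous.
apply: (squeeze_cvgr _ (cvg_cst 0) root0).
near=> t.
have t1 : (1 : R) <= t%:R by rewrite ler1n; near: t; exact: nbhs_infty_ge.
(* [ln t <= 4 * t ^ (1/4)] *)
set r := Num.sqrt (Num.sqrt (t%:R : R)).
have r2 : Num.sqrt (t%:R : R) = r ^+ 2 by rewrite sqr_sqrtr// sqrtr_ge0.
have r4 : (t%:R : R) = r ^+ 4 by rewrite (exprM r 2 2) -r2 sqr_sqrtr// ler0n.
have r0 : 0 < r by rewrite !sqrtr_gt0; lra.
rewrite !sqrtrV ?sqrtr_ge0// -/r divr_ge0 ?ln_ge0 ?sqrtr_ge0//=.
rewrite r2 r4 lnXn// ler_pdivrMr ?exprn_gt0//.
rewrite expr2 -mulrA mulKf ?gt_eqF// -[leLHS]mulr_natl ler_wpM2l// ltW//.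
exact: ln_sublinear.
Unshelve. all: by end_near. Qed.

Lemma log_delta_radius_cvg0 {R : realType} (delta A B : R) : 0 < delta ->
  (A + B * ln (2 / delta_at delta t)) / Num.sqrt t%:R @[t --> \oo] --> 0.
Proof.
(* [K] is the part of [ln (2 / delta_at delta t)] independent of [t]; the rest is [2 * ln t]. *)
move=> d0; pose K : R := ln (pi ^+ 2 / (3 * delta)).
have : (A + B * K) * (Num.sqrt (t%:R : R))^-1
    + 2 * B * (ln (t%:R : R) / Num.sqrt t%:R) @[t --> \oo] --> 0.
  have h := cvgD (cvgMl_tmp (a := A + B * K) inv_sqrt_cvg0)
    (cvgMl_tmp (a := 2 * B) ln_div_sqrt_cvg0).
  rewrite !mulr0 addr0 in h; exact: h.
apply: cvg_trans; apply: near_eq_cvg; near=> t.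
have t0 : (0 : R) < t%:R by rewrite ltr0n; near: t; exact: nbhs_infty_gt.
have p0 := pi_gt0 R.
have -> : 2 / delta_at delta t = pi ^+ 2 / (3 * delta) * t%:R ^+ 2.
  by rewrite /delta_at; move: (pi : R) p0 => p p0; field; rewrite !gt_eqF.
rewrite lnM ?posrE ?exprn_gt0// ?divr_gt0 ?exprn_gt0 ?mulr_gt0//.
rewrite lnXn// -/K -[ln _ *+ 2]mulr_natl; ring.
Unshelve. all: by end_near. Qed.

(** Replaces square roots of logarithms in the radii by affine expressions. *)
Lemma sqrtr_le1D {R : realType} (x : R) : 0 <= x -> Num.sqrt x <= 1 + x.
Proof.
move=> x0; rewrite -[leRHS]ger0_norm; last by lra.
rewrite -sqrtr_sqr ler_wsqrtr// sqrrD; nra.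
Qed.

(** * Common form of bound for the three radii *)

Section radii.
Context {R : realType} (delta : R) (t : nat).
Context (delta01 : 0 < delta < 1) (t_gt0 : (0 < t)%N).

Let L := ln (2 / delta_at delta t).

Let d_gt0 : 0 < delta_at delta t.
Proof. by apply: delta_at_gt0 => //; case/andP: delta01. Qed.

Let d_le2 : delta_at delta t <= 2.
Proof. exact: delta_at_le2. Qed.

Let L_ge0 : 0 <= L.
Proof. by rewrite ln_ge0// ler_pdivlMr// mul1r. Qed.

Lemma ci_radius_le : ci_radius delta t <= (2^-1 + 1 * L) / Num.sqrt t%:R.
Proof.
have s0 : 0 < Num.sqrt (t%:R : R) by rewrite sqrtr_gt0 ltr0n.
have q : std_normal_quantile (1 - delta_at delta t / 2) <= 2^-1 + 1 * L.
  have -> : 1 * L = ln (delta_at delta t / 2)^-1 by rewrite mul1r invf_div.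
  by apply: std_normal_quantile_le; rewrite divr_gt0//= ler_pdivrMr// mul1r.
(* The factor 2 in the denominator is given up, the bound being nonnegative. *)
rewrite /ci_radius ler_pdivrMr ?mulr_gt0// mulrCA divfK ?gt_eqF//.
apply: le_trans q _; have := L_ge0. lra.
Qed.

Lemma l2_radius_le n : l2_radius n delta t <= (1 + 2 * n%:R * L) / Num.sqrt t%:R.
Proof.
have nL0 : 0 <= 2 * n%:R * L by rewrite !mulr_ge0.
by rewrite /l2_radius sqrtrM// sqrtrV// ler_wpM2r ?invr_ge0// sqrtr_le1D.
Qed.

(** With [d] the level, [ln (1 / d) <= ln (2 / d) = L], so the bracket is at most [2 + (1 + 2 * L)],
    whence the constants 3 and 2. *)
Lemma kernel_radius_le C : kernel_radius C delta t <=
  (3 * Num.sqrt C + 2 * Num.sqrt C * L) / Num.sqrt t%:R.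
Proof.
have h : Num.sqrt (2 * ln (1 / delta_at delta t)) <= 1 + 2 * L.
  apply: le_trans (sqrtr_le1D _ _); last by rewrite mulr_ge0.
  have i0 : 0 < (delta_at delta t)^-1 by rewrite invr_gt0.
  rewrite ler_wsqrtr// ler_wpM2l// ler_ln ?posrE ?mulr_gt0//.
  by rewrite ler_wpM2r ?ltW// ltr1n.
rewrite /kernel_radius mulrAC ler_wpM2r ?invr_ge0//.
rewrite (_ : _ + _ = Num.sqrt C * (2 + (1 + 2 * L))); last by ring.
by rewrite ler_wpM2l// lerD2l.
Qed.

End radii.

(** * Shrinking of the ambiguity sets *)

Lemma l2norm_coord {R : realType} {S : finType} (q : 'cV[R]_#|S|) k :
  `|q k 0| <= l2norm q.
Proof.
rewrite -sqrtr_sqr ler_wsqrtr// (bigD1 k)//= lerDl.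
by apply: sumr_ge0 => i _; exact: sqr_ge0.
Qed.

(** Both points are compared with the centre [phat]. Since [rho] is chosen before [phat], one
    deterministic rate serves every outcome. *)
Lemma ambiguity_set_shrinks {R : realType} {S : finType} (a : ambiguity_type R S)
    (delta : R) : 0 < delta < 1 -> valid_ambiguity a ->
  exists2 rho : nat -> R, rho t @[t --> \oo] --> 0 &
    forall t phat p q, (0 < t)%N ->
      ambiguity_set a delta t phat p -> ambiguity_set a delta t phat q ->
      forall k, `|p k 0 - q k 0| <= rho t.
Proof.
move=> delta01 va; have d0 : 0 < delta by case/andP: delta01.
(* [c] turns the radius into a bound on coordinates: 1 for the first two types, the Cauchy-Schwarz
   constant for kernels. *)
suff [c [A [B [c0 cAB]]]] : exists c A B : R, 0 <= c /\
    forall t phat p, (0 < t)%N -> ambiguity_set a delta t phat p ->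
    forall k, `|p k 0 - phat k 0| <=
      c * ((A + B * ln (2 / delta_at delta t)) / Num.sqrt t%:R).
  exists (fun t => 2 * c * ((A + B * ln (2 / delta_at delta t)) / Num.sqrt t%:R)).
    rewrite -[X in _ --> X](mulr0 (2 * c)); apply: cvgMl_tmp.
    exact: log_delta_radius_cvg0.
  move=> t phat p q t0 Qp Qq k; apply: le_trans (ler_distD (phat k 0) _ _) _.
  rewrite -mulrA [leRHS]mulr_natl mulr2n; apply: lerD; first exact: cAB.
  by rewrite distrC; exact: cAB.
case: a va => [_|_|kM C [/posdefmx_coord[c c0 hc] _]].
- exists 1, 2^-1, 1; split => // t phat p t0 [_ /= hp] k.
  rewrite mul1r; apply: le_trans (ci_radius_le _ _ delta01 t0).
  by rewrite ler_distl.
- exists 1, 1, (2 * #|S|%:R); split => // t phat p t0 [_ /= hp] k.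
  rewrite mul1r; apply: le_trans (l2_radius_le _ _ delta01 t0 _).
  by apply: le_trans hp; have := l2norm_coord (p - phat) k; rewrite !mxE.
- exists c, (3 * Num.sqrt C), (2 * Num.sqrt C); split => // t phat p t0 [_ /= hp] k.
  apply: (@le_trans _ _ (c * mxnorm (kernel_mx kM) (p - phat))).
    by have := hc (p - phat) k; rewrite !mxE.
  rewrite ler_wpM2l//; apply: le_trans hp _; exact: kernel_radius_le.
Qed.

Theorem theorem2p2 (R : realType) (d : nat) (X : set 'rV[R]_d) (S : finType)
    (f : 'rV[R]_d -> S -> R)
    (disp : measure_display) (Omega : measurableType disp)
    (P : probability Omega R) (xi : nat -> Omega -> S) (pstar : 'cV[R]_#|S|)
    (delta : R) (a : ambiguity_type R S) :
  compact X ->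
  simplex pstar ->
  iid_scenarios P xi pstar ->
  0 < delta < 1 ->
  valid_ambiguity a ->
  (forall t : nat, (0 < t)%N ->
    ((1 - delta_at delta t)%:E <=
      P [set w | ambiguity_set a delta t (empirical xi t w) pstar])%E) ->
  {ae P, forall w,
    robust_value X f (ambiguity_set a delta t (empirical xi t w))
      @[t --> \oo] --> stochastic_value X f pstar}.
Proof.
move=> _ _ [mxi _ _] delta01 va confidence.
have d0 : 0 < delta by case/andP: delta01.
have [rho rho0 shrink] := ambiguity_set_shrinks _ _ delta01 va.
pose E t := [set w | ambiguity_set a delta t (empirical xi t w) pstar].
have mE t : measurable (E t).
  exact: (measurable_empirical _ (fun p => ambiguity_set a delta t p pstar)).
(* The index is shifted because the coverage bound starts at time 1. *)
have sumE : (\sum_(0 <= t <oo) P (~` E t.+1) < +oo)%E.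
  apply: (@le_lt_trans _ _ (6 * delta / pi ^+ 2 * 2)%:E); last exact: ltry.
  apply: lime_le; first by apply: is_cvg_nneseries.
  apply: nearW => n.
  apply: (@le_trans _ _ (\sum_(0 <= t < n) (6 * delta / pi ^+ 2 * t.+1%:R ^- 2)%:E)%E).
    apply: lee_sum => t _; rewrite probability_setC//.
    have -> : 6 * delta / pi ^+ 2 * t.+1%:R ^- 2 = delta_at delta t.+1.
      by rewrite /delta_at -mulrA -invfM.
    rewrite leeBlDr ?fin_num_measure// addeC -leeBlDr//; exact: confidence.
  rewrite sumEFin lee_fin -mulr_sumr ler_wpM2l ?sum_inv_sqr_le2//.
  by apply: divr_ge0; [lra|exact: sqr_ge0].
have := Borel_Cantelli_event _ _ (fun t => mE t.+1) sumE.
apply: filterS => w Ew.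
have evE : \forall t \near \oo, E t w.
  case: Ew => n _ Ew; exists n.+1 => // -[//|t] /= nt; exact: Ew.
apply: (robust_value_cvg _ _ _ _ rho) => //.
(* Starting at [n.+1] ensures [0 < t], as [shrink] asks. *)
case: evE => n _ evE; exists n.+1 => // t /= nt p Qp k.
apply: (shrink t (empirical xi t w)) => //; first exact: leq_trans nt.
by apply: evE; exact: ltnW.
Qed.
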